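(* There is a family $(L_n)_{n\ge0}$ of substitutable languages over a finite alphabet (that is, $h$-substitutable for the morphism $h$ onto the trivial one-element monoid) such that, for each $n$ and this $h$, $(L_n,h)$ is unit-separated and satisfies PTLD, has exactly one relative prime ($q=1$), has $\eta_{\mathrm{cut}}(L_n,h)=0$, the language $L_n$ is generated by a context-free grammar of size $O(n)$, and the canonical direct relative-prime grammar of $(L_n,h)$ has structural thickness $\tau=2^n$.
   Context: For $L\subseteq\Sigma^*$ and a monoid morphism $h:\Sigma^*\to M$ into a finite monoid: $D_L(x)=\{(u,v):uxv\in L\}$; $x\equiv_L y$ iff $D_L(x)=D_L(y)$. $L$ is $h$-substitutable if $h(x)=h(y)$ and $D_L(x)\cap D_L(y)\ne\varnothing$ imply $x\equiv_L y$. The relative syntactic congruence $\theta$: $x\,\theta\,y$ iff $x\equiv_L y$ and $h(x)=h(y)$; its classes $[x]$ are relative classes; $h(P)$ is the common $h$-value of a class $P$. A class is live if $D_L(x)\ne\varnothing$ for its members; the unit class is $[\varepsilon]$; $(L,h)$ is unit-separated if $[\varepsilon]=\{\varepsilon\}$. $X\cdot Y=\{xy:x\in X,y\in Y\}$; $X*Y=[xy]$ for $x\in X,y\in Y$. A relative prime is a live class $P\ne[\varepsilon]$ such that $P=X\cdot Y$ (as sets) with relative classes $X,Y$ forces one of them to be $[\varepsilon]$; $\mathcal P$ is the set of relative primes and $q=|\mathcal P|$. For a prime sequence $\alpha=P_1\cdots P_k$: $\overline\alpha=P_1\cdot\ldots\cdot P_k$, $[\overline\alpha]=P_1*\cdots*P_k$.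 $P\to\alpha$ ($P\in\mathcal P$, $|\alpha|\ge2$) is correct if $[\overline\alpha]=P$, and valid if moreover no proper contiguous block $\beta$ of $\alpha$ with $|\beta|\ge2$ has $[\overline\beta]\in\mathcal P$. PTLD: with $\mathsf T=h(\{x:D_L(x)\neq\varnothing\})$, for all $m,r,r'\in\mathsf T$ and every relative prime $P$, $mr=h(P)=mr'$ implies $r=r'$. When $L$ is $h$-substitutable, unit-separated, PTLD with finite $\mathcal P$, every live non-unit class has a unique exact factorization $X=\overline\alpha$ into relative primes, and the canonical direct relative-prime grammar $G^\star$ has nonterminals $\mathcal P$ and a start symbol $S$, with rules: all valid productions, the lexical rules $P\to a$ for $a\in P\cap\Sigma$, and, for each non-unit relative class $X\subseteq L$, $S\to\alpha$ with $\alpha$ the unique exact prime factorization of $X$. For a sentential form $\alpha$, $\ell(\alpha)=\min\{|w|:\alpha\Rightarrow^*w\in\Sigma^*\}$; the structural thickness $\tau$ is the maximum of $\ell(\alpha)$ over all rules $B\to\alpha$ of $G^\star$. With $\omega(P)$ the shortlex-least word of $P$, $\eta_{\mathrm{cut}}(L,h)$ is the maximum, over all $P\in\mathcal P$ and cuts $\omega(P)=uv$ with $u,v\neq\varepsilon$, of $\min\{|x|:x\in P\setminus([u]\cdot[v])\}$, and is $0$ if there are no such cuts. *)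

(* Defs.v *)
From HB Require Import structures.
From Stdlib Require Import Relation_Operators.
From mathcomp Require Import all_boot all_order.
From mathcomp Require Import classical_sets cardinality.

Set Implicit Arguments.
Unset Strict Implicit.
Unset Printing Implicit Defensive.

Local Open Scope classical_set_scope.

HB.instance Definition _ (A : choiceType) :=
  isMonoid.Build (seq A) (@catA A) (@cat0s A) (@cats0 A).

Lemma unit_mulA : associative (fun _ _ : unit => tt). Proof. by []. Qed.
Lemma unit_mul1 : left_id tt (fun _ _ : unit => tt). Proof. by case. Qed.
Lemma unit_mulr1 : right_id tt (fun _ _ : unit => tt). Proof. by case. Qed.

HB.instance Definition _ := isMonoid.Build unit unit_mulA unit_mul1 unit_mulr1.

Notation monoid_hom := UMagmaMorphism.type.

Definition trivial_hom (A : choiceType) : seq A -> unit := fun=> tt.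

Lemma trivial_hom_morphism (A : choiceType) :
  monoid_morphism (@trivial_hom A).
Proof. by []. Qed.

HB.instance Definition _ (A : choiceType) :=
  isMultiplicative.Build (seq A) unit (@trivial_hom A)
    (trivial_hom_morphism A).2.
HB.instance Definition _ (A : choiceType) :=
  Multiplicative_isUMagmaMorphism.Build (seq A) unit (@trivial_hom A)
    (trivial_hom_morphism A).1.

Definition least (E : set nat) (m : nat) : Prop := E m /\ lbound E m.

(* t is the maximum of min E over E in F, all these minima being defined. *)
Definition max_of_mins (F : set (set nat)) (t : nat) : Prop :=
  (exists2 E, F E & least E t) /\
  (forall E, F E -> exists2 m, least E m & m <= t).

Section Grammars.
Variable A : eqType.

(* The rules are a relation, so that the grammar may a priori be infinite. *)
Record grammar := Grammar {
  nonterm : Type;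
  rule : nonterm -> seq (nonterm + A) -> Prop;
  start : nonterm }.

Definition step (G : grammar) (s t : seq (nonterm G + A)) : Prop :=
  exists l B r al,
    [/\ s = l ++ inl B :: r, rule B al & t = l ++ al ++ r].

Definition derives (G : grammar) := clos_refl_trans_1n _ (@step G).

Definition yields (G : grammar) (s : seq (nonterm G + A)) : set (seq A) :=
  [set w | derives s (map inr w)].

Definition generated (G : grammar) : set (seq A) :=
  yields [:: inl (start G)].

Definition form_lengths (G : grammar) (s : seq (nonterm G + A)) : set nat :=
  size @` yields s.

(* [structural_thickness G t]: l(al) is defined for every right-hand side al,
   and the maximum of these values is t. *)
Definition structural_thickness (G : grammar) (t : nat) : Prop :=
  max_of_mins [set form_lengths al | al in [set al | exists B : nonterm G,
                                                     rule B al]] t.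

Record cfg := Cfg {
  cfg_nonterm : finType;
  cfg_rules : seq (cfg_nonterm * seq (cfg_nonterm + A));
  cfg_start : cfg_nonterm }.

Definition grammar_of_cfg (G : cfg) : grammar :=
  {| nonterm := cfg_nonterm G;
     rule := fun B al => (B, al) \in cfg_rules G;
     start := cfg_start G |}.

(* Both sides of each rule are counted, and the nonterminals are added, so
   that this bounds the usual measures of size. *)
Definition cfg_size (G : cfg) : nat :=
  #|cfg_nonterm G| + \sum_(r <- cfg_rules G) (size r.2).+1.

End Grammars.

Section RelativePrimes.
Variables (A : choiceType) (M : monoidType).
Variables (L : set (seq A)) (h : monoid_hom (seq A) M).
Implicit Types (x y w : seq A) (X Y : set (seq A)).

Definition contexts x : set (seq A * seq A) :=
  [set uv | L (uv.1 ++ x ++ uv.2)].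

Definition synt_equiv x y : Prop := contexts x = contexts y.

Definition substitutable : Prop :=
  forall x y, h x = h y -> contexts x `&` contexts y !=set0 -> synt_equiv x y.

Definition rel_congr x y : Prop := synt_equiv x y /\ h x = h y.

Definition rel_class x : set (seq A) := [set y | rel_congr x y].

Definition rel_classes : set (set (seq A)) := range rel_class.

Definition unit_class : set (seq A) := rel_class [::].

(* The common h-value of the words of a (nonempty) class. *)
Definition class_val X : M := h (xget [::] X).

Definition live_word : set (seq A) := [set x | contexts x !=set0].

Definition live X : Prop := X `<=` live_word.

Definition unit_separated : Prop := unit_class = [set [::]].

Definition concat X Y : set (seq A) := [set x ++ y | x in X & y in Y].

(* For relative classes X and Y all the classes in this union coincide. *)
Definition class_mul X Y : set (seq A) := \bigcup_(w in concat X Y) rel_class w.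

Definition rel_primes : set (set (seq A)) :=
  [set P | [/\ rel_classes P, live P, P <> unit_class &
    forall X Y, rel_classes X -> rel_classes Y -> P = concat X Y ->
      X = unit_class \/ Y = unit_class]].

Definition PTLD : Prop :=
  forall m r r' P, (h @` live_word) m -> (h @` live_word) r ->
    (h @` live_word) r' -> rel_primes P ->
    (m * r)%g = class_val P -> class_val P = (m * r')%g -> r = r'.

Definition prime_class : Type := set_type rel_primes.

Definition prime_seq := seq prime_class.

Definition set_prod (al : prime_seq) : set (seq A) :=
  foldr concat [set [::]] (map val al).

Definition class_prod (al : prime_seq) : set (seq A) :=
  foldr class_mul unit_class (map val al).

Definition correct (P : prime_class) (al : prime_seq) : Prop :=
  2 <= size al /\ class_prod al = val P.

Definition valid (P : prime_class) (al : prime_seq) : Prop :=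
  correct P al /\
  (forall be : prime_seq, infix be al -> be <> al -> 2 <= size be ->
     ~ rel_primes (class_prod be)).

Definition prime_form (al : prime_seq) : seq (option prime_class + A) :=
  [seq inl (Some P) | P <- al].

(* The start symbol is None. *)
Inductive prime_rule :
    option prime_class -> seq (option prime_class + A) -> Prop :=
| ValidRule (P : prime_class) (al : prime_seq) :
    valid P al -> prime_rule (Some P) (prime_form al)
| LexicalRule (P : prime_class) (a : A) :
    val P [:: a] -> prime_rule (Some P) [:: inr a]
| StartRule (X : set (seq A)) (al : prime_seq) :
    rel_classes X -> X <> unit_class -> X `<=` L ->
    unique (fun be : prime_seq => X = set_prod be) al ->
    prime_rule None (prime_form al).

Definition prime_grammar : grammar A :=
  {| nonterm := option prime_class; rule := prime_rule; start := None |}.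

End RelativePrimes.

Definition shortlex d (A : orderType d) (x y : seq A) : bool :=
  (size x < size y) ||
  (size x == size y) && ((x : seqlexi A) <= (y : seqlexi A))%O.

Definition shortlex_least d (A : orderType d) (P : set (seq A)) (w : seq A) :
    Prop :=
  P w /\ forall x, P x -> shortlex w x.

Section EtaCut.
Variables (d : Order.disp_t) (A : orderType d) (M : monoidType).
Variables (L : set (seq A)) (h : monoid_hom (seq A) M).

(* (P, (u, v)) with u and v nonempty and uv the shortlex-least word of P. *)
Definition cuts : set (set (seq A) * (seq A * seq A)) :=
  [set c | [/\ rel_primes L h c.1, c.2.1 <> [::], c.2.2 <> [::] &
    shortlex_least c.1 (c.2.1 ++ c.2.2)]].

Definition cut_defect (c : set (seq A) * (seq A * seq A)) : set (seq A) :=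
  c.1 `\` concat (rel_class L h c.2.1) (rel_class L h c.2.2).

(* [eta_cut t]: the invariant is defined and its value is t. *)
Definition eta_cut (t : nat) : Prop :=
  (cuts = set0 /\ t = 0) \/
  max_of_mins [set size @` cut_defect c | c in cuts] t.

End EtaCut.

(* Main.v *)
(** Over a one-letter alphabet let L_n be the singleton {a^(2^n)}. A word of
    length at most 2^n has contexts that determine its length, and the longer
    words form one dead class; so {a} is the only relative prime and every live
    class {a^k} factors as {a}^k. No production on {a} is correct, and the only
    start rule has 2^n occurrences of {a} on its right, whereas n doubling rules
    suffice for an ordinary grammar. *)
Require Import Defs.
From Stdlib Require Import Relation_Operators.
From mathcomp Require Import all_boot all_order.
From mathcomp Require Import classical_sets cardinality.

Set Implicit Arguments.
Unset Strict Implicit.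
Unset Printing Implicit Defensive.

Local Open Scope classical_set_scope.

(** * Derivations and a length invariant for grammars *)

Section Derivations.
Variables (A : eqType) (G : grammar A).
Implicit Types (s t : seq (nonterm G + A)) (B : nonterm G).

Lemma derives_trans s t u : derives s t -> derives t u -> derives s u.
Proof. by elim=> // s1 s2 s3 s12 _ IH /IH; apply: rt1n_trans. Qed.

Lemma derives_step s t : step s t -> derives s t.
Proof. by move=> st; apply: rt1n_trans st (rt1n_refl _ _ _). Qed.

Lemma derives_rule B al : rule B al -> derives [:: inl B] al.
Proof.
move=> Bal; apply: derives_step; exists [::], B, [::], al.
by split; rewrite ?cats0.
Qed.

Lemma derives_catl u s t : derives s t -> derives (u ++ s) (u ++ t).
Proof.
elim=> [s1|s1 s2 s3 [l [B [r [al [-> Bal ->]]]]] _ IH]; first exact: rt1n_refl.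
apply: derives_trans IH; apply: derives_step.
by exists (u ++ l), B, r, al; split; rewrite ?catA.
Qed.

Lemma derives_catr u s t : derives s t -> derives (s ++ u) (t ++ u).
Proof.
elim=> [s1|s1 s2 s3 [l [B [r [al [-> Bal ->]]]]] _ IH]; first exact: rt1n_refl.
apply: derives_trans IH; apply: derives_step.
by exists l, B, (r ++ u), al; split; rewrite -?catA.
Qed.

Lemma derives_cat s s' t t' :
  derives s s' -> derives t t' -> derives (s ++ t) (s' ++ t').
Proof.
move=> ss' ord0'.
exact: derives_trans (derives_catr t ss') (derives_catl s' ord0').
Qed.

Lemma yields_nonempty s :
  (forall B, yields [:: inl B] !=set0) -> yields s !=set0.
Proof.
move=> prod; elim: s => [|[B|a] s [w sw]]; first by exists [::]; apply: rt1n_refl.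
- have [v Bv] := prod B; exists (v ++ w).
  by rewrite /yields /= map_cat -cat1s; apply: derives_cat.
- by exists (a :: w); rewrite /yields /= -cat1s -[inr a :: _]cat1s; apply: derives_catl.
Qed.

(** [f B] is meant to be the common length of all words derived from [B]. Once every rule preserves
    [weight], lengths can be read off sentential forms without analysing derivations. *)
Variable f : nonterm G -> nat.

Definition weight s : nat :=
  sumn [seq (if X is inl B then f B else 1) | X <- s].

Lemma weight_cat s t : weight (s ++ t) = weight s + weight t.
Proof. by rewrite /weight map_cat sumn_cat. Qed.

Lemma weight_terminal (w : seq A) : weight (map inr w) = size w.
Proof. by rewrite /weight; elim: w => //= a w ->. Qed.

Hypothesis f_rule : forall B al, rule B al -> weight al = f B.

Lemma derives_weight s t : derives s t -> weight s = weight t.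
Proof.
elim=> // s1 s2 s3 [l [B [r [al [-> /f_rule Bal ->]]]]] _ <-.
by rewrite -cat1s !weight_cat Bal /weight /= addn0.
Qed.

Lemma yields_size s w : yields s w -> size w = weight s.
Proof. by move/derives_weight->; rewrite weight_terminal. Qed.

Lemma form_lengths_weight s :
  (forall B, yields [:: inl B] !=set0) -> form_lengths s = [set weight s].
Proof.
move=> /(yields_nonempty s)[w sw]; apply/seteqP; split=> k /=.
  by move=> [v sv <-]; apply: yields_size.
by move=> ->; exists w => //; apply: yields_size.
Qed.

End Derivations.

(** * Relative classes form a congruence *)

Section RelativeClasses.
Variables (A : choiceType) (M : monoidType).
Variables (L : set (seq A)) (h : monoid_hom (seq A) M).
Implicit Types (x y : seq A).

Lemma rel_class_refl x : rel_class L h x x.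
Proof. by []. Qed.

Lemma rel_class_eq x y : rel_class L h x y -> rel_class L h x = rel_class L h y.
Proof.
rewrite /rel_class /rel_congr /synt_equiv => -[cxy hxy].
by apply/seteqP; split=> z /=; rewrite cxy hxy.
Qed.

(** One factor is exchanged at a time: first [x] against [x'] with [y] moved into the right context,
    then [y] against [y'] with [x'] moved into the left one; the converse inclusion is similar. *)
Lemma rel_class_cat x y x' y' :
  rel_class L h x x' -> rel_class L h y y' -> rel_class L h (x ++ y) (x' ++ y').
Proof.
move=> [cx hx] [cy hy]; split; last first.
  by rewrite -[x ++ y]/((x * y)%g) -[x' ++ y']/((x' * y')%g) !gmulfM hx hy.
apply/seteqP; split=> -[u v]; rewrite /contexts /= -!catA => Lw.
- have : contexts L x (u, y ++ v) by [].
  rewrite cx /contexts /= catA => {}Lw.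
  have : contexts L y (u ++ x', v) by [].
  by rewrite cy /contexts /= -!catA.
- have : contexts L x' (u, y' ++ v) by [].
  rewrite -cx /contexts /= catA => {}Lw.
  have : contexts L y' (u ++ x, v) by [].
  by rewrite -cy /contexts /= -!catA.
Qed.

Lemma class_mul_rel_class x y :
  class_mul L h (rel_class L h x) (rel_class L h y) = rel_class L h (x ++ y).
Proof.
apply/seteqP; split=> z.
  by move=> [_ [x' xx' [y' yy' <-]]]; rewrite (rel_class_eq (rel_class_cat xx' yy')).
by move=> xyz; exists (x ++ y) => //; exists x => //; exists y.
Qed.

End RelativeClasses.

(** This reduces all later equalities of words to equalities of lengths. *)
Lemma seq_ord1_inj : injective (size : seq 'I_1 -> nat).
Proof. by elim=> [|a s IH] [|b t] //= [/IH->]; rewrite (ord1 a) (ord1 b). Qed.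

(** * The singleton language of one unary word *)

Section UnaryWord.
Variable N : nat.
(** For N = 0 only the empty word would be live, and there would be no prime. *)
Hypothesis N_gt0 : 0 < N.

Definition unary_lang : set (seq 'I_1) := [set w | size w = N].

Let L := unary_lang.
Let h : monoid_hom (seq 'I_1) unit := @trivial_hom 'I_1.
Implicit Types (x y : seq 'I_1).

Lemma unary_contextsE x u v : contexts L x (u, v) <-> size u + size x + size v = N.
Proof. by rewrite /contexts /L /unary_lang /= !size_cat addnA. Qed.

Lemma unary_live_word x : live_word L x <-> size x <= N.
Proof.
split=> [[[u v] /unary_contextsE <-]|lexN]; first by rewrite -addnA addnCA leq_addr.
exists (nseq (N - size x) ord0, [::]); apply/unary_contextsE.
by rewrite size_nseq addn0 subnK.
Qed.

(** A shared context (u, v) forces both lengths to be N - |u| - |v|. Substitutability and the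
    triviality of live classes both follow. *)
Lemma unary_contexts_meet x y :
  contexts L x `&` contexts L y !=set0 -> x = y.
Proof.
move=> [[u v] [/unary_contextsE xE /unary_contextsE]]; rewrite -xE.
by move/addIn/addnI => /seq_ord1_inj.
Qed.

Lemma unary_rel_class x : size x <= N -> rel_class L h x = [set x].
Proof.
move=> /unary_live_word [c xc]; apply/seteqP; split=> y /=; last by move=> ->.
move=> [cxy _]; apply/esym/unary_contexts_meet.
by exists c; split; rewrite -?cxy.
Qed.

Lemma unary_unit_class : unit_class L h = [set [::]].
Proof. exact: unary_rel_class. Qed.

Lemma unary_rel_primes : rel_primes L h = [set [set [:: ord0]]].
Proof.
have class1 := @unary_rel_class [:: ord0] N_gt0.
apply/seteqP; split=> P /=; last first.
  move=> ->; split.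
  - by exists [:: ord0].
  - by move=> _ ->; apply/unary_live_word.
  - by rewrite unary_unit_class => /seteqP[/(_ _ erefl)].
  (* Splitting the one-letter word leaves an empty piece on one side, and the factor containing it
     is the unit class. *)
  move=> _ _ [x _ <-] [y _ <-] /seteqP[/(_ _ erefl) [[|a x'] xx' [y' yy' xy]] _].
    by left; apply: rel_class_eq.
  by case: y' x' yy' xy {xx'} => [|b y'] [|c x'] // yy' _; right; apply: rel_class_eq.
move=> [[x _ <-] /(_ _ (rel_class_refl _ _ _)) /unary_live_word lexN xn1 prim].
move: xn1 prim; rewrite unary_unit_class unary_rel_class //.
case: x lexN => [|a x] //; rewrite (ord1 a) => ltxN _ prim.
(* Splitting off the first letter is an exact factorization; since the class of the letter is not
   the unit class, primality makes the remainder [x] empty. *)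
have clx := @unary_rel_class x (ltnW ltxN).
have [||||clx1] := prim (rel_class L h [:: ord0]) (rel_class L h x).
- by exists [:: ord0].
- by exists x.
- rewrite class1 clx; apply/seteqP; split=> z /=.
    by move=> ->; exists [:: ord0] => //; exists x.
  by move=> [_ -> [_ -> <-]].
- by rewrite class1 => /seteqP[/(_ _ erefl)].
by move: clx1; rewrite clx => /seteqP[/(_ _ erefl) /= ->].
Qed.

Lemma unary_primeP : rel_primes L h [set [:: ord0]].
Proof. by rewrite unary_rel_primes. Qed.

Definition unary_prime : prime_class L h := SigSub (mem_set unary_primeP).

Lemma val_unary_prime (P : prime_class L h) : val P = [set [:: ord0]].
Proof.
have : rel_primes L h (val P) by apply/set_mem/valP.
by move: (val P) => X; rewrite unary_rel_primes.
Qed.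

Lemma unary_prime_unique (P : prime_class L h) : P = unary_prime.
Proof. by apply: val_inj; rewrite !val_unary_prime. Qed.

Lemma unary_set_prod (al : prime_seq L h) :
  set_prod al = [set nseq (size al) ord0].
Proof.
rewrite /set_prod; elim: al => //= P al ->; rewrite val_unary_prime.
apply/seteqP; split=> z /=; first by move=> [_ -> [_ -> <-]].
by move=> ->; exists [:: ord0] => //; exists (nseq (size al) ord0).
Qed.

(** The class cannot be replaced by a singleton here: beyond length N the word is dead and its class
    is infinite. *)
Lemma unary_class_prod (al : prime_seq L h) :
  class_prod al = rel_class L h (nseq (size al) ord0).
Proof.
rewrite /class_prod; elim: al => //= P al ->.
by rewrite val_unary_prime -(@unary_rel_class [:: ord0]) // class_mul_rel_class.
Qed.

(** The class of a word of length at least 2, live or dead, contains that word, so it is not the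
    class of the single letter. *)
Lemma unary_not_correct (P : prime_class L h) (al : prime_seq L h) :
  ~ correct P al.
Proof.
move=> [+ /seteqP[+ _]]; rewrite unary_class_prod val_unary_prime => sz.
by move=> /(_ _ (rel_class_refl _ _ _)) /(congr1 size); rewrite size_nseq /= => szE; rewrite szE in sz.
Qed.

Let G := prime_grammar L h.

Lemma unary_start_rule : @rule _ G None (prime_form (nseq N unary_prime)).
Proof.
apply: (@StartRule _ _ L h (rel_class L h (nseq N ord0))).
- by exists (nseq N ord0).
- rewrite unary_unit_class unary_rel_class ?size_nseq // => /seteqP[/(_ _ erefl) /=].
  by move/(congr1 size); rewrite size_nseq => /eqP; rewrite eqn0Ngt N_gt0.
- by rewrite unary_rel_class ?size_nseq // => _ ->; apply: size_nseq.
- rewrite unary_rel_class ?size_nseq //; split; first by rewrite unary_set_prod size_nseq.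
  move=> be; rewrite unary_set_prod => /seteqP[/(_ _ erefl) /= /(congr1 size) + _].
  rewrite !size_nseq => ->.
  (* With a single prime available, a prime sequence is determined by its length. *)
  by elim: be => //= P be ->; rewrite (unary_prime_unique P).
Qed.

Definition unary_prime_weight (B : nonterm G) : nat := if B is Some _ then 1 else N.

Lemma weight_prime_form (al : prime_seq L h) :
  weight unary_prime_weight (prime_form al) = size al.
Proof. by rewrite /weight /prime_form; elim: al => //= P al ->. Qed.

(** There are no valid productions, a lexical rule has weight 1, and the product on the right of a
    start rule lies in [L], so it has N factors. *)
Lemma unary_prime_rule_weight (B : nonterm G) al :
  rule B al -> weight unary_prime_weight al = unary_prime_weight B.
Proof.
case=> {B al} [P al [/unary_not_correct[]]|P a _ //|X al _ _ XL [Xal _]].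
rewrite weight_prime_form /=; move: XL; rewrite Xal unary_set_prod => /(_ _ erefl).
by rewrite /L /unary_lang /= size_nseq.
Qed.

Lemma unary_prime_yields (B : nonterm G) : yields [:: inl B] !=set0.
Proof.
have yP (P : prime_class L h) : @yields _ G [:: inl (Some P)] [:: ord0].
  by apply: derives_rule; apply: LexicalRule; rewrite val_unary_prime.
case: B => [P|]; first by exists [:: ord0]; apply: yP.
exists (nseq N ord0).
apply: derives_trans (derives_rule unary_start_rule) _.
elim: (N) => [|k IH]; first exact: rt1n_refl.
exact: (derives_cat (yP unary_prime) IH).
Qed.

Lemma unary_structural_thickness : structural_thickness G N.
Proof.
have lenE := form_lengths_weight unary_prime_rule_weight _ unary_prime_yields.
have least1 k : least [set k] k by split=> // j /= ->.
split.
  exists [set N] => //; exists (prime_form (nseq N unary_prime)).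
    by exists None; apply: unary_start_rule.
  by rewrite lenE weight_prime_form size_nseq.
move=> _ [al [B /unary_prime_rule_weight Bal] <-]; rewrite lenE Bal.
by exists (unary_prime_weight B) => //; case: B {Bal}.
Qed.

Lemma unary_substitutable : substitutable L h.
Proof. by move=> x y _ /unary_contexts_meet ->. Qed.

(** The only word of the only prime is too short to have two nonempty pieces. *)
Lemma unary_cuts : cuts L h = set0.
Proof.
rewrite -subset0 => -[P [u v]] []; rewrite /= unary_rel_primes => ->.
by case: u v => [|a [|b u]] [|c v] //= _ _ [].
Qed.

End UnaryWord.

(** * A linear-size grammar by repeated doubling *)

Section Doubling.
Variable n : nat.

(** Nonterminal i produces the word of length 2^i. In the doubling rules [lift ord0 i] is the index
    i + 1 and [widen_ord] keeps the index i. *)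
Definition doubling_cfg : cfg 'I_1 :=
  {| cfg_nonterm := 'I_n.+1;
     cfg_rules := (ord0, [:: inr ord0]) ::
       [seq (lift ord0 i, nseq 2 (inl (widen_ord (leqnSn n) i))) | i <- enum 'I_n];
     cfg_start := ord_max |}.

Let G := grammar_of_cfg doubling_cfg.

Lemma doubling_rule_weight (B : nonterm G) al :
  rule B al -> weight (fun i : nonterm G => 2 ^ (i : 'I_n.+1)) al = 2 ^ (B : 'I_n.+1).
Proof.
rewrite /rule /= inE => /orP[/eqP[-> ->] //|/mapP[i _ [-> ->]]].
by rewrite /weight /= addn0 addnn -mul2n -expnS.
Qed.

Lemma doubling_yields (B : nonterm G) : yields [:: inl B] !=set0.
Proof.
case: B => k; elim: k => [|k IH] lt_k.
  exists [:: ord0]; apply: derives_rule.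
  by rewrite /rule /= inE; apply/orP; left; apply/eqP; congr pair; apply: val_inj.
have [w kw] := IH (ltnW lt_k); exists (w ++ w).
rewrite /yields /= map_cat.
apply: derives_trans (derives_cat kw kw); apply: derives_rule.
rewrite /rule /= inE; apply/orP; right; apply/mapP.
exists (Ordinal (lt_k : k < n)); first by rewrite mem_enum.
congr pair; first exact: val_inj.
by rewrite /=; congr [:: inl _; inl _]; apply: val_inj.
Qed.

Lemma doubling_generated : generated G = unary_lang (2 ^ n).
Proof.
have sizeE w : generated G w -> size w = 2 ^ n.
  by move/(yields_size doubling_rule_weight); rewrite /weight /= addn0.
apply/seteqP; split=> w; first exact: sizeE.
(* One derived word suffices, since any other word of length 2^n equals it. *)
have [v Gv] := doubling_yields (start G).
by rewrite /unary_lang /= -(sizeE v Gv) => /seq_ord1_inj ->.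
Qed.

(** The nonterminals contribute n + 1, the lexical rule 2, and each of the n doubling rules 3. *)
Lemma doubling_size : cfg_size doubling_cfg = 4 * n + 3.
Proof.
rewrite /cfg_size /= card_ord big_cons big_map /= big_enum sum_nat_const card_ord.
by rewrite addSn addnCA -mulnS mulnC addnC -addnS.
Qed.

End Doubling.

Theorem proposition15p18 :
  exists (d : Order.disp_t) (A : finOrderType d) (L : nat -> set (seq A))
         (G : nat -> cfg A),
    (forall n : nat,
       let h : monoid_hom (seq A) unit := @trivial_hom A in
       substitutable (L n) h /\
       unit_separated (L n) h /\
       PTLD (L n) h /\
       (rel_primes (L n) h #= `I_1)%card /\
       eta_cut (L n) h 0 /\
       generated (grammar_of_cfg (G n)) = L n /\
       structural_thickness (prime_grammar (L n) h) (2 ^ n)) /\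
    (exists C n0 : nat, forall n : nat, n0 <= n -> cfg_size (G n) <= C * n).
Proof.
exists _, 'I_1, (fun n => unary_lang (2 ^ n)), doubling_cfg; split=> [n h|].
  have N_gt0 : 0 < 2 ^ n by rewrite expn_gt0.
  do 6?[split].
  - exact: unary_substitutable.
  - exact: unary_unit_class.
  - by move=> m [] [].
  - by rewrite (unary_rel_primes N_gt0); apply: card_set1.
  - by left; split=> //; apply: unary_cuts.
  - exact: doubling_generated.
  - exact: unary_structural_thickness.
(* For n at least 1, 4n + 3 is at most 4n + 3n; at n = 0 the size is 3, so the bound starts at 1. *)
by exists 7, 1 => n n_gt0; rewrite doubling_size (mulnDl 4 3) leq_add2l leq_pmulr.
Qed.
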